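(* For every given $\lambda\ge 0$, the stationary policy $u(x,\lambda)=-K(\lambda)x+l(\lambda)$ stabilizes the system, i.e. the spectral radius of $A-BK(\lambda)$ is strictly less than $1$.
   Context: System: $x_{t+1}=Ax_t+Bu_t+w_t$ with $x_t\in\mathbb{R}^n$, $u_t\in\mathbb{R}^m$, $A\in\mathbb{R}^{n\times n}$, $B\in\mathbb{R}^{n\times m}$, and i.i.d. noise $w_t\in\mathbb{R}^n$ with finite fourth moment. Standing assumptions: $Q\in\mathbb{R}^{n\times n}$ is symmetric positive semi-definite, $R\in\mathbb{R}^{m\times m}$ is symmetric positive definite, $(A,B)$ is stabilizable and $(A,Q^{1/2})$ is observable. Notation: $\bar w=\mathbb{E}[w_t]$, $W=\mathbb{E}[(w_t-\bar w)(w_t-\bar w)^\top]$, $M_3=\mathbb{E}[(w_t-\bar w)(w_t-\bar w)^\top Q(w_t-\bar w)]$. For $\lambda\ge0$ let $Q_\lambda=Q+4\lambda QWQ$, $S=2QM_3$. Let $P=P(\lambda)$ be the unique positive semi-definite solution of the algebraic Riccati equation $P=Q_\lambda+A^\top PA-A^\top PB(R+B^\top PB)^{-1}B^\top PA$, let $K(\lambda)=(R+B^\top PB)^{-1}B^\top PA$, let $g\in\mathbb{R}^n$ solve $g^\top=(2\bar w^\top P+g^\top)(A-BK(\lambda))+2\lambda S^\top$, and let $l(\lambda)=-\tfrac12(R+B^\top PB)^{-1}B^\top(2P\bar w+g)$. *)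

(* Defs.v *)
From HB Require Import structures.
From mathcomp Require Import all_boot all_order all_algebra.
From mathcomp Require Import complex.
From mathcomp Require Import all_classical all_reals all_analysis.

Set Implicit Arguments.
Unset Strict Implicit.
Unset Printing Implicit Defensive.

Import Order.TTheory GRing.Theory Num.Theory.
Import numFieldNormedType.Exports.

Local Open Scope classical_set_scope.
Local Open Scope ring_scope.

Section LinearAlgebra.
Variable R : realType.

Definition psd n (M : 'M[R]_n) : Prop :=
  M^T = M /\ forall x : 'cV[R]_n, 0 <= (x^T *m M *m x) 0 0.

Definition pd n (M : 'M[R]_n) : Prop :=
  M^T = M /\ forall x : 'cV[R]_n, x != 0 -> 0 < (x^T *m M *m x) 0 0.

(* [is_psd_sqrt M S] says S = M^{1/2}: for psd M there is exactly one such S. *)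
Definition is_psd_sqrt n (M S : 'M[R]_n) : Prop := psd S /\ S *m S = M.

(* The spectrum is the complex one: M is mapped to matrices over R[i].  For
   n = 0 the set is empty and its [sup] is 0. *)
Definition spectral_radius n (M : 'M[R]_n) : R :=
  sup [set Normc.normc z | z in
        [set z : R[i] | eigenvalue (map_mx (real_complex R) M) z]].

Definition stabilizable n m (A : 'M[R]_n) (B : 'M[R]_(n, m)) : Prop :=
  exists K : 'M[R]_(m, n), spectral_radius (A - B *m K) < 1.

(* Kalman observability matrix: the blocks C, CA, ..., CA^(n-1) stacked. *)
Definition observability_mx n p (A : 'M[R]_n) (C : 'M[R]_(p, n)) :=
  \mxcol_(k < n) (C *m A ^+ k).

Definition observable n p (A : 'M[R]_n) (C : 'M[R]_(p, n)) : Prop :=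
  \rank (observability_mx A C) = n.

Definition affine_policy n m (K : 'M[R]_(m, n)) (l : 'cV[R]_m)
    (x : 'cV[R]_n) : 'cV[R]_m := - (K *m x) + l.

(* The stationary policy u makes x' = A x + B u(x) + w an affine recursion
   whose linear part has spectral radius < 1; K and l are determined by u. *)
Definition stabilizes n m (A : 'M[R]_n) (B : 'M[R]_(n, m))
    (u : 'cV[R]_n -> 'cV[R]_m) : Prop :=
  exists (K : 'M[R]_(m, n)) (l : 'cV[R]_m),
    u =1 affine_policy K l /\ spectral_radius (A - B *m K) < 1.

End LinearAlgebra.

Section Noise.
Context d (T : measurableType d) (R : realType) (Pr : probability T R).

Definition borel_cV n : set (set 'cV[R]_n) :=
  <<s [set U : set 'cV[R]_n | open U] >>.

Definition random_vector n (v : T -> 'cV[R]_n) : Prop :=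
  forall E, borel_cV E -> measurable (v @^-1` E).

Definition identically_distributed n (w : nat -> T -> 'cV[R]_n) : Prop :=
  forall s t E, borel_cV E -> Pr (w s @^-1` E) = Pr (w t @^-1` E).

Definition mutually_independent n (w : nat -> T -> 'cV[R]_n) : Prop :=
  forall (J : seq nat) (E : nat -> set 'cV[R]_n), uniq J ->
    (forall t, borel_cV (E t)) ->
    Pr (\bigcap_(t in [set` J]) (w t @^-1` E t)) =
    (\prod_(t <- J) Pr (w t @^-1` E t))%E.

Definition iid n (w : nat -> T -> 'cV[R]_n) : Prop :=
  [/\ forall t, random_vector (w t), identically_distributed w
    & mutually_independent w].

(* E |v|^4 < oo for the Euclidean norm, |v|^4 being (v^T v)^2. *)
Definition finite_fourth_moment n (v : T -> 'cV[R]_n) : Prop :=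
  ('E_Pr[fun omega => ((((v omega)^T *m v omega) 0 0) ^+ 2)%R] < +oo)%E.

(* Entrywise expectation; [fine] sends a non-finite expectation to 0. *)
Definition expect_mx p q (X : T -> 'M[R]_(p, q)) : 'M[R]_(p, q) :=
  \matrix_(i, j) fine ('E_Pr[fun omega => X omega i j])%E.

Definition mean n (v : T -> 'cV[R]_n) : 'cV[R]_n := expect_mx v.

Definition centered n (v : T -> 'cV[R]_n) (omega : T) : 'cV[R]_n :=
  v omega - mean v.

Definition cov_mx n (v : T -> 'cV[R]_n) : 'M[R]_n :=
  expect_mx (fun omega => centered v omega *m (centered v omega)^T).

Definition third_moment n (Q : 'M[R]_n) (v : T -> 'cV[R]_n) : 'cV[R]_n :=
  expect_mx (fun omega =>
    centered v omega *m (centered v omega)^T *m Q *m centered v omega).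

End Noise.

Section RiskAwareLQR.
Context (R : realType) (n m : nat).
Variables (A : 'M[R]_n) (B : 'M[R]_(n, m)) (Ru : 'M[R]_m).

Definition Q_infl (Q W : 'M[R]_n) (lambda : R) : 'M[R]_n :=
  Q + (4 * lambda) *: (Q *m W *m Q).

Definition input_weight (P : 'M[R]_n) : 'M[R]_m := Ru + B^T *m P *m B.

Definition riccati_eq (Ql P : 'M[R]_n) : Prop :=
  P = Ql + A^T *m P *m A
      - A^T *m P *m B *m invmx (input_weight P) *m B^T *m P *m A.

Definition gain (P : 'M[R]_n) : 'M[R]_(m, n) :=
  invmx (input_weight P) *m B^T *m P *m A.

Definition affine_eq (P : 'M[R]_n) (wbar S : 'cV[R]_n) (lambda : R)
    (g : 'cV[R]_n) : Prop :=
  g^T = (2 *: (wbar^T *m P) + g^T) *m (A - B *m gain P)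
        + (2 * lambda) *: S^T.

Definition offset (P : 'M[R]_n) (wbar g : 'cV[R]_n) : 'cV[R]_m :=
  - (2^-1 *: (invmx (input_weight P) *m B^T *m (2 *: (P *m wbar) + g))).

End RiskAwareLQR.

(* Main.v *)
Require Import Defs.
From HB Require Import structures.
From mathcomp Require Import all_boot all_order all_algebra.
From mathcomp Require Import complex.
From mathcomp Require Import all_classical all_reals all_analysis.
From mathcomp Require Import measurable_realfun ring lra.

Set Implicit Arguments.
Unset Strict Implicit.
Unset Printing Implicit Defensive.

Import Order.TTheory GRing.Theory Num.Theory.
Import numFieldNormedType.Exports.

Local Open Scope classical_set_scope.
Local Open Scope ring_scope.

(** The closed-loop matrix is [M := A - B K].  Completing the square turns the
    Riccati equation into the Lyapunov equation [P = N + M^T P M] with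
    [N = Q_lambda + K^T R K] ([riccati_lyapunov]), so [x^T P x] is an energy
    that decreases by [x^T N x >= 0] at each step of the closed loop.

    On an eigenvector of [M] with eigenvalue [z] the energy is multiplied by
    [|z|^2].  If [|z| >= 1] it cannot decrease, so the eigenvector is a null
    vector of the form [N] ([lyapunov_spectral_radius_lt1]).  Now [x^T N x] is
    the sum of [|Q^(1/2) x|^2], of [4 lambda (Q x)^T W (Q x)] and of
    [(K x)^T R (K x)], three nonnegative terms; their vanishing forces
    [Q^(1/2) x = 0] and, [R] being definite, [K x = 0].  Then [M x = A x], and
    [x] is an eigenvector of [A] in the kernel of [Q^(1/2)], against
    observability ([observable_eigenpair_eq0]).

    The noise enters only through [W >= 0]; its finite fourth moment makes the
    entries of [W] expectations of integrable functions, so that [y^T W y] is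
    the expectation of a square ([cov_mx_quad_ge0]).

    Eigenvectors are complex while [P] and [N] are real; an eigenvector for
    [al + i be] is handled as the pair [(a, b)] of its real and imaginary parts,
    with [M a = al a - be b] and [M b = be a + al b], and its energy as the sum
    of the energies of [a] and [b]. *)

(** * Quadratic forms *)

Section QuadraticForms.
Context {R : realType}.

Definition quad n (M : 'M[R]_n) (x : 'cV[R]_n) : R := (x^T *m M *m x) 0 0.

Lemma quadD n (M N : 'M[R]_n) x : quad (M + N) x = quad M x + quad N x.
Proof. by rewrite /quad mulmxDr mulmxDl mxE. Qed.

Lemma quadZ n (c : R) (M : 'M[R]_n) x : quad (c *: M) x = c * quad M x.
Proof. by rewrite /quad -scalemxAr -scalemxAl mxE. Qed.

Lemma quad_congr n p (C : 'M[R]_(p, n)) (M : 'M[R]_p) x :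
  quad (C^T *m M *m C) x = quad M (C *m x).
Proof. by rewrite /quad trmx_mul !mulmxA. Qed.

Lemma quad_dot n (x : 'cV[R]_n) : quad 1%:M x = \sum_i x i 0 ^+ 2.
Proof.
by rewrite /quad mulmx1 mxE; apply: eq_bigr => i _; rewrite mxE expr2.
Qed.

Lemma quad_gram n p (C : 'M[R]_(p, n)) x :
  quad (C^T *m C) x = \sum_i (C *m x) i 0 ^+ 2.
Proof. by rewrite -[C^T in LHS]mulmx1 quad_congr quad_dot. Qed.

Lemma quad_gram_ge0 n p (C : 'M[R]_(p, n)) x : 0 <= quad (C^T *m C) x.
Proof. by rewrite quad_gram sumr_ge0 // => i _; rewrite sqr_ge0. Qed.

Lemma quad_gram_eq0 n p (C : 'M[R]_(p, n)) x :
  quad (C^T *m C) x <= 0 -> C *m x = 0.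
Proof.
move=> le0; have /eqP := le_anti (introT andP (conj le0 (quad_gram_ge0 C x))).
rewrite quad_gram psumr_eq0 => [/allP h|i _]; last exact: sqr_ge0.
apply/matrixP => i j; rewrite ord1 [RHS]mxE; apply/eqP.
by have := h i (mem_index_enum i); rewrite implyTb sqrf_eq0.
Qed.

(** The cross terms cancel, even for a matrix that is not symmetric: this is
    [(z x)^* P (z x) = |z|^2 x^* P x] for [x = a + i b] and [z = al + i be]. *)
Lemma quad_rotate n (P : 'M[R]_n) (a b : 'cV[R]_n) (al be : R) :
  quad P (al *: a - be *: b) + quad P (be *: a + al *: b) =
  (al ^+ 2 + be ^+ 2) * (quad P a + quad P b).
Proof.
rewrite /quad !linearD !linearN /= !linearZ /=.
rewrite !(mulmxDl, mulNmx, mulmxN, mulmxDr) !(=^~ scalemxAl, =^~ scalemxAr).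
rewrite !mulNmx !mxE; ring.
Qed.

Lemma pd_quad_gt0 n (M : 'M[R]_n) x : pd M -> x != 0 -> 0 < quad M x.
Proof. by move=> [_]; apply. Qed.

Lemma pd_quad_ge0 n (M : 'M[R]_n) x : pd M -> 0 <= quad M x.
Proof.
move=> M_pd; have [->|x0] := eqVneq x 0; last exact/ltW/pd_quad_gt0.
by rewrite /quad mulmx0 mxE.
Qed.

Lemma quad_gt0_unitmx n (M : 'M[R]_n) :
  (forall x, x != 0 -> 0 < quad M x) -> M \in unitmx.
Proof.
move=> Mgt0; rewrite unitmxE unitfE; apply/negP => /det0P[v v0 vM].
have /Mgt0 : v^T != 0 by rewrite trmx_eq0.
by rewrite /quad trmxK vM mul0mx mxE ltxx.
Qed.
End QuadraticForms.

(** * Eigenvalues, Lyapunov equations and observability *)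

Section Spectrum.
Context {R : realType}.

(** [eigenvalue] speaks of row vectors; a column eigenvector for the same
    eigenvalue exists because a determinant is invariant under transposition. *)
Lemma real_eigenpair n (M : 'M[R]_n) (z : R[i]) :
  eigenvalue (map_mx (real_complex R) M) z ->
  exists a b : 'cV[R]_n,
    [/\ M *m a = complex.Re z *: a - complex.Im z *: b,
        M *m b = complex.Im z *: a + complex.Re z *: b
      & (a != 0) || (b != 0)].
Proof.
set MC := map_mx _ M => /eigenvalueP[v vM v0].
have : \det (MC - z%:M) == 0.
  by apply/det0P; exists v; rewrite // mulmxBr vM mul_mx_scalar subrr.
rewrite -det_tr => /det0P[u u0 /(congr1 trmx)].
rewrite trmx_mul trmxK trmx0 mulmxBl mul_scalar_mx => /subr0_eq Mu.
have Mu_i i : \sum_j (M i j)%:C%C * u 0 j = z * u 0 i.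
  have := congr1 (fun w : 'cV_n => w i 0) Mu; rewrite !mxE => <-.
  by apply: eq_bigr => j _; rewrite !mxE.
exists (\col_i complex.Re (u 0 i)), (\col_i complex.Im (u 0 i)); split.
- apply/colP => i; rewrite !mxE.
  transitivity (complex.Re (z * u 0 i)); last first.
    by case: z {Mu vM Mu_i} (u 0 i) => ? ? [].
  rewrite -Mu_i raddf_sum; apply: eq_bigr => j _; rewrite !mxE.
  by case: (u 0 j) => x y /=; rewrite mul0r subr0.
- apply/colP => i; rewrite !mxE.
  transitivity (complex.Im (z * u 0 i)); last first.
    by case: z {Mu vM Mu_i} (u 0 i) => ? ? [] ? ? /=; rewrite addrC.
  rewrite -Mu_i raddf_sum; apply: eq_bigr => j _; rewrite !mxE.
  by case: (u 0 j) => x y /=; rewrite mul0r addr0.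
- apply: contraNT u0; rewrite negb_or !negbK => /andP[/eqP a0 /eqP b0].
  apply/eqP/rowP => i; move: (congr1 (fun w : 'cV_n => w i 0) a0).
  move: (congr1 (fun w : 'cV_n => w i 0) b0); rewrite !mxE.
  by case: (u 0 i) => x y /= -> ->.
Qed.

(** A supremum of numbers below [1] may be [1]; here it is a maximum, as
    the eigenvalues are the finitely many roots of the characteristic
    polynomial. *)
Lemma spectral_radius_lt1 n (M : 'M[R]_n) :
  (forall z, eigenvalue (map_mx (real_complex R) M) z -> Normc.normc z < 1) ->
  spectral_radius M < 1.
Proof.
move=> lt1; rewrite /spectral_radius; set E := [set _ | _ in _].
have [->|E0] := eqVneq E set0; first by rewrite sup0.
have [rs chi_rs] :=
  closed_field_poly_normal (char_poly (map_mx (real_complex R) M)).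
have eig_rs z : eigenvalue (map_mx (real_complex R) M) z = (z \in rs).
  rewrite eigenvalue_root_char chi_rs (monicP (char_poly_monic _)) scale1r.
  exact: root_prod_XsubC.
apply: (@le_lt_trans _ _ (\big[Num.max/0]_(z <- rs) Normc.normc z)).
  apply: ge_sup; first exact/set0P.
  by move=> _ [z /= + <-]; rewrite eig_rs => z_rs; apply: le_bigmax_seq.
rewrite big_seq; elim/big_ind: _ => //.
  by move=> x y x1 y1; rewrite gt_max x1 y1.
by move=> z z_rs; apply: lt1; rewrite eig_rs.
Qed.

(** Summing the energies of the real and imaginary parts, the equation gives
    [E = E_N + |z|^2 E] with [E, E_N >= 0], so [|z| >= 1] forces [E_N = 0].  The
    last hypothesis is the detectability of [(M, N)], tested on eigenvectors as
    in the Popov-Belevitch-Hautus criterion. *)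
Lemma lyapunov_spectral_radius_lt1 n (M N P : 'M[R]_n) :
  psd P -> P = N + M^T *m P *m M -> (forall x, 0 <= quad N x) ->
  (forall (a b : 'cV[R]_n) (al be : R),
     M *m a = al *: a - be *: b -> M *m b = be *: a + al *: b ->
     quad N a <= 0 -> quad N b <= 0 -> a = 0 /\ b = 0) ->
  spectral_radius M < 1.
Proof.
move=> [_ P_ge0] P_eq N_ge0 N_detects.
apply: spectral_radius_lt1 => z /real_eigenpair[a [b [Ma Mb ab0]]].
rewrite ltNge; apply/negP => z1.
have z2 : 1 <= complex.Re z ^+ 2 + complex.Im z ^+ 2.
  move: z1; case: (z) => al be /=.
  by rewrite -[X in X <= _]sqrtr1 ler_sqrt ?addr_ge0 ?sqr_ge0.
have energy : quad P a + quad P b = quad N a + quad N b +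
    (complex.Re z ^+ 2 + complex.Im z ^+ 2) * (quad P a + quad P b).
  rewrite -quad_rotate -Ma -Mb -!quad_congr {1 2}P_eq !quadD; ring.
have Pa := P_ge0 a; have Pb := P_ge0 b; rewrite -/(quad P _) in Pa Pb.
have Na := N_ge0 a; have Nb := N_ge0 b.
have grow : quad P a + quad P b <=
    (complex.Re z ^+ 2 + complex.Im z ^+ 2) * (quad P a + quad P b).
  by rewrite ler_peMl ?addr_ge0.
have [a0 b0] : a = 0 /\ b = 0 by apply: (N_detects _ _ _ _ Ma Mb); lra.
by move: ab0; rewrite a0 b0 eqxx.
Qed.

(** The span of [a] and [b] is invariant under [A] and lies in the kernel of
    [C], so every block [C A^k] kills it; but the stack of these blocks, having
    rank [n], is injective on column vectors. *)
Lemma observable_eigenpair_eq0 n p (A : 'M[R]_n) (C : 'M[R]_(p, n))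
    (a b : 'cV[R]_n) (al be : R) :
  observable A C ->
  A *m a = al *: a - be *: b -> A *m b = be *: a + al *: b ->
  C *m a = 0 -> C *m b = 0 -> a = 0 /\ b = 0.
Proof.
move=> /eqP/row_fullP[L LO] Aa Ab Ca Cb.
have CA k : C *m A ^+ k *m a = 0 /\ C *m A ^+ k *m b = 0.
  elim: k => [|k [IHa IHb]]; first by rewrite expr0 mulmx1.
  rewrite exprSr mulmxA -!mulmxA Aa Ab !mulmxA.
  rewrite mulmxBr mulmxDr -!scalemxAr IHa IHb !scaler0.
  by rewrite subr0 addr0.
have O0 x : (forall k, C *m A ^+ k *m x = 0) -> x = 0.
  move=> Cx; rewrite -[x]mul1mx -LO -mulmxA mxcol_mul.
  under eq_mxcol do rewrite Cx.
  by rewrite mxcol0 mulmx0.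
by split; apply: O0 => k; case: (CA k).
Qed.

End Spectrum.

(** * The noise covariance *)

Section Moments.
Context d (T : measurableType d) (R : realType) (Pr : probability T R).

(** Borel sets of column vectors are generated by the open sets, so coordinates
    are measurable because they are continuous. *)
Lemma measurable_coord n (v : T -> 'cV[R]_n) i :
  random_vector v -> measurable_fun setT (fun omega => v omega i 0).
Proof.
move=> v_rv; apply: (measurability _ (RGenOpens.measurableE R)).
move=> _ [_ [x [y ->]] <-]; rewrite setTI.
have := v_rv ((fun M : 'cV[R]_n => M i 0) @^-1` `]x, y[); apply.
apply: sub_sigma_algebra => /=; apply: open_comp; last exact: itv_open.
by move=> M _; exact: coord_continuous.
Qed.

Lemma finite_fourth_moment_integrable n (v : T -> 'cV[R]_n) :
  random_vector v -> finite_fourth_moment Pr v ->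
  Pr.-integrable setT
    (EFin \o (fun omega => ((v omega)^T *m v omega) 0 0 ^+ 2)).
Proof.
move=> v_rv v4; apply/integrableP; split.
  apply/measurable_EFinP.
  rewrite (_ : (fun _ => _) = fun omega => (\sum_i v omega i 0 ^+ 2) ^+ 2).
    apply: measurable_funX; apply: measurable_sum => i.
    by apply: measurable_funX; exact: measurable_coord.
  apply/funext => omega; congr (_ ^+ 2); rewrite mxE.
  by apply: eq_bigr => i _; rewrite mxE expr2.
move: v4; rewrite /finite_fourth_moment unlock.
rewrite (_ : (\int[Pr]_x `|_|)%E = (\int[Pr]_w
   ((((v w)^T *m v w) 0 0) ^+ 2)%:E)%E) //.
by apply: eq_integral => omega _ /=; rewrite ger0_norm ?sqr_ge0.
Qed.

(** With [s := v^T v], every [v_k^2] is at most [s] and [2 s <= 1 + s^2], so the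
    products are dominated by a constant plus [s^2], the function whose integral
    is the fourth moment. *)
Lemma integrable_coord_product n (v : T -> 'cV[R]_n) (c : 'cV[R]_n) i j :
  random_vector v -> finite_fourth_moment Pr v ->
  Pr.-integrable setT
    (EFin \o (fun omega => (v omega - c) i 0 * (v omega - c) j 0)).
Proof.
move=> v_rv v4; pose s omega := ((v omega)^T *m v omega) 0 0.
pose C := 1 + c i 0 ^+ 2 + c j 0 ^+ 2.
have s_int := finite_fourth_moment_integrable v_rv v4.
have dom_int := integrableD measurableT
  (finite_measure_integrable_cst Pr C measurableT) s_int.
apply: (le_integrable measurableT _ _ dom_int).
  apply/measurable_EFinP; apply: measurable_funM.
    under eq_fun do rewrite !mxE.
    by apply: measurable_funB; [exact: measurable_coord|exact: measurable_cst].
  under eq_fun do rewrite !mxE.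
  by apply: measurable_funB; [exact: measurable_coord|exact: measurable_cst].
move=> omega _; rewrite /= lee_fin -/(s omega).
have sq_le k : v omega k 0 ^+ 2 <= s omega.
  rewrite /s mxE (bigD1 k) //= mxE -expr2 lerDl sumr_ge0 // => l _.
  by rewrite mxE -expr2 sqr_ge0.
have si := sq_le i; have sj := sq_le j; rewrite !mxE.
move: (s omega) (v omega i 0) (v omega j 0) si sj => {dom_int s_int} r x y.
move=> si sj.
have ui : (x - c i 0) ^+ 2 <= 2 * (r + c i 0 ^+ 2).
  by have := sqr_ge0 (x + c i 0); lra.
have uj : (y - c j 0) ^+ 2 <= 2 * (r + c j 0 ^+ 2).
  by have := sqr_ge0 (y + c j 0); lra.
have r1 : 2 * r <= 1 + r ^+ 2 by have := sqr_ge0 (r - 1); lra.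
move: (x - _) (y - _) ui uj => p q ui uj.
apply: (le_trans _ (ler_norm _)); rewrite /C ler_norml; apply/andP; split.
  by have := sqr_ge0 (p + q); lra.
by have := sqr_ge0 (p - q); lra.
Qed.

(** The form is the expectation of [(x^T X)^2].  Integrability of the products
    is what allows the quadratic form to be moved inside the expectation: an
    infinite entry would be sent to [0] by [fine]. *)
Lemma second_moment_quad_ge0 n (X : T -> 'cV[R]_n) (x : 'cV[R]_n) :
  (forall i j,
    Pr.-integrable setT (EFin \o (fun omega => X omega i 0 * X omega j 0))) ->
  0 <= (x^T *m expect_mx Pr (fun omega => X omega *m (X omega)^T) *m x) 0 0.
Proof.
move=> X_int.
(* The double sum is indexed by pairs, to exchange it with the integral once. *)
pose h (k : 'I_n * 'I_n) omega : \bar R :=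
  ((x k.1 0 * x k.2 0)%:E * (X omega k.1 0 * X omega k.2 0)%:E)%E.
have h_int k : Pr.-integrable setT (h k).
  exact: (integrableZl measurableT _ (X_int k.1 k.2)).
suff -> : (x^T *m expect_mx Pr (fun omega => X omega *m (X omega)^T) *m x) 0 0 =
    fine (\int[Pr]_omega (\sum_k h k omega)).
  apply: fine_ge0; apply: integral_ge0 => omega _.
  rewrite sumEFin lee_fin.
  rewrite (_ : (\sum_(_ <- _) _) = (\sum_i x i 0 * X omega i 0) ^+ 2).
    exact: sqr_ge0.
  rewrite expr2 big_distrlr /= pair_big /=; apply: eq_bigr => k _; ring.
rewrite integral_sum // -sum_fine; last first.
  by move=> k _; exact: integrable_fin_num.
transitivity (\sum_i \sum_j fine (\int[Pr]_omega h (i, j) omega)); last first.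
  by rewrite pair_big /=; apply: eq_bigr => -[].
rewrite exchange_big mxE; apply: eq_bigr => j _.
rewrite mxE mulr_suml; apply: eq_bigr => i _.
rewrite (integralZl measurableT (X_int i j)) fineM //; last first.
  exact: (integrable_fin_num measurableT (X_int i j)).
rewrite mulrAC !mxE unlock /=; congr (_ * fine _).
by apply: eq_integral => omega _; rewrite !mxE big_ord1 !mxE.
Qed.

Lemma cov_mx_quad_ge0 n (v : T -> 'cV[R]_n) (x : 'cV[R]_n) :
  random_vector v -> finite_fourth_moment Pr v ->
  0 <= (x^T *m cov_mx Pr v *m x) 0 0.
Proof.
move=> v_rv v4; apply: second_moment_quad_ge0 => i j.
exact: integrable_coord_product.
Qed.
End Moments.

(** * From the Riccati to the Lyapunov equation *)

Section Riccati.
Context {R : realType} (n m : nat).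
Variables (A : 'M[R]_n) (B : 'M[R]_(n, m)) (Ru : 'M[R]_m).

Lemma input_weight_unitmx (P : 'M[R]_n) :
  pd Ru -> psd P -> input_weight B Ru P \in unitmx.
Proof.
move=> Ru_pd [_ P_ge0]; apply: quad_gt0_unitmx => x x0.
rewrite /input_weight quadD quad_congr.
exact: ltr_pwDl (pd_quad_gt0 Ru_pd x0) (P_ge0 _).
Qed.

(** Since [(R + B^T P B) K = B^T P A], the term [K^T B^T P A] of the expanded
    [(A - B K)^T P (A - B K)] equals [K^T R K + K^T B^T P B K], and only
    [A^T P A - A^T P B K - K^T R K] remains. *)
Lemma riccati_lyapunov (Ql P : 'M[R]_n) :
  pd Ru -> psd P -> riccati_eq A B Ru Ql P ->
  let K := gain A B Ru P in
  P = Ql + K^T *m Ru *m K + (A - B *m K)^T *m P *m (A - B *m K).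
Proof.
move=> Ru_pd P_psd P_ric /=; set K := gain A B Ru P.
have weightK : input_weight B Ru P *m K = B^T *m P *m A.
  by rewrite /K /gain !mulmxA mulmxV ?mul1mx // input_weight_unitmx.
have {}P_ric : P = Ql + A^T *m P *m A - A^T *m P *m B *m K.
  by rewrite [LHS]P_ric /K /gain !mulmxA.
have KweightK :
    K^T *m Ru *m K + K^T *m B^T *m P *m B *m K = K^T *m B^T *m P *m A.
  by have := congr1 (mulmx K^T) weightK; rewrite mulmxDl mulmxDr !mulmxA.
clearbody K; rewrite [LHS]P_ric [(A - _)^T]linearB /= [(B *m K)^T]trmx_mul.
rewrite mulmxBl mulmxBr !mulmxBl !mulmxA -KweightK opprB addrA.
by rewrite opprD !addrA subrK (addrAC Ql (K^T *m Ru *m K)) addrK.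
Qed.

Lemma quad_Q_infl (Q W : 'M[R]_n) (lambda : R) (x : 'cV[R]_n) : Q^T = Q ->
  quad (Q_infl Q W lambda) x = quad Q x + 4 * lambda * quad W (Q *m x).
Proof. by move=> Q_sym; rewrite quadD quadZ -quad_congr Q_sym. Qed.

End Riccati.

(** * Stability of the closed loop *)

Theorem lemma2 (R : realType) (n m : nat)
  (A : 'M[R]_n) (B : 'M[R]_(n, m)) (Q Qhalf : 'M[R]_n) (Ru : 'M[R]_m)
  (d : measure_display) (T : measurableType d) (Pr : probability T R)
  (w : nat -> T -> 'cV[R]_n)
  (w_iid : iid Pr w)
  (w_moment4 : forall t, finite_fourth_moment Pr (w t))
  (Q_psd : psd Q)
  (Ru_pd : pd Ru)
  (AB_stabilizable : stabilizable A B)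
  (Q_sqrt : is_psd_sqrt Q Qhalf)
  (AQ_observable : observable A Qhalf)
  (lambda : R) (lambda_ge0 : 0 <= lambda)
  (P : 'M[R]_n) (g : 'cV[R]_n) :
  let wbar := mean Pr (w 0%N) in
  let W := cov_mx Pr (w 0%N) in
  let M3 := third_moment Pr Q (w 0%N) in
  let S := 2 *: (Q *m M3) in
  let K := gain A B Ru P in
  let l := offset B Ru P wbar g in
  psd P ->
  riccati_eq A B Ru (Q_infl Q W lambda) P ->
  affine_eq A B Ru P wbar S lambda g ->
  stabilizes A B (affine_policy K l) /\ spectral_radius (A - B *m K) < 1.
Proof.
move=> wbar W M3 S K l P_psd P_ric _.
suff Acl_lt1 : spectral_radius (A - B *m K) < 1.
  by split=> //; exists K, l.
have W_ge0 x : 0 <= quad W x.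
  by case: w_iid => w_rv _ _; exact: cov_mx_quad_ge0.
have [Q_sym _] := Q_psd; have [[Qhalf_sym _] Qhalf_sq] := Q_sqrt.
have Q_gram : Q = Qhalf^T *m Qhalf by rewrite Qhalf_sym.
pose N := Q_infl Q W lambda + K^T *m Ru *m K.
have quadN x : quad N x =
    quad Q x + 4 * lambda * quad W (Q *m x) + quad Ru (K *m x).
  by rewrite /N quadD quad_Q_infl // quad_congr.
have inflation_ge0 x : 0 <= 4 * lambda * quad W (Q *m x).
  by rewrite !mulr_ge0.
have state_ge0 x : 0 <= quad Q x by rewrite Q_gram quad_gram_ge0.
have input_ge0 x : 0 <= quad Ru (K *m x) by exact: pd_quad_ge0.
have N_ge0 x : 0 <= quad N x by rewrite quadN !addr_ge0.
have N_null x : quad N x <= 0 -> Qhalf *m x = 0 /\ K *m x = 0.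
  rewrite quadN => Nx; have := inflation_ge0 x; have := state_ge0 x.
  have := input_ge0 x => Rx Qx Wx; split.
    by apply: quad_gram_eq0; rewrite -Q_gram; lra.
  apply/eqP; apply: contraT => /(pd_quad_gt0 Ru_pd) Kx; lra.
apply: (lyapunov_spectral_radius_lt1 P_psd (riccati_lyapunov Ru_pd P_psd P_ric)
  N_ge0) => a b al be Acl_a Acl_b /N_null[Ca Ka] /N_null[Cb Kb].
(* With K a = K b = 0, the closed and open loops agree on a and b. *)
have Aa : A *m a = al *: a - be *: b.
  by rewrite -Acl_a mulmxBl -mulmxA Ka mulmx0 subr0.
have Ab : A *m b = be *: a + al *: b.
  by rewrite -Acl_b mulmxBl -mulmxA Kb mulmx0 subr0.
exact: (observable_eigenpair_eq0 AQ_observable Aa Ab Ca Cb).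
Qed.
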